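(* Let $\pi$ be a permutation of $[n]$ and let $1 \leq d \leq \operatorname{des}(\pi)$. Then $\operatorname{ls}_d(\pi) = \operatorname{is}(\pi) + d$ if and only if $\operatorname{asc}(\pi) = \operatorname{is}(\pi) - 1$.
   Context: Permutations of $[n]=\{1,\dots,n\}$ are written as words $\pi(1)\cdots\pi(n)$. For a sequence $\sigma$ of length $m$ of distinct numbers, $\operatorname{des}(\sigma)$ is the number of $i\in[m-1]$ with $\sigma(i)>\sigma(i+1)$, and $\operatorname{asc}(\sigma)$ is the number of $i\in[m-1]$ with $\sigma(i)<\sigma(i+1)$. For $I=\{i_1<\cdots<i_k\}\subseteq[n]$, $\pi_I=\pi(i_1)\cdots\pi(i_k)$. $\operatorname{is}(\pi)$ is the length of a longest increasing subsequence of $\pi$. For $d\ge0$, $\operatorname{ls}_d(\pi)=\max\{\#I : I\subseteq[n],\ \operatorname{des}(\pi_I)=d\}$ (equal to $0$ if there is no such $I$). *)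

(* Defs.v *)
From mathcomp Require Import all_boot all_fingroup.

Set Implicit Arguments.
Unset Strict Implicit.
Unset Printing Implicit Defensive.

(* Permutations of [n] are elements of 'S_n, so positions and values are
   numbered from 0 to n - 1 instead of from 1 to n; ascents, descents and
   subsequence lengths do not depend on this shift. *)

Definition des (s : seq nat) : nat :=
  #|[set i : 'I_(size s).-1 | nth 0 s i.+1 < nth 0 s i]|.

Definition asc (s : seq nat) : nat :=
  #|[set i : 'I_(size s).-1 | nth 0 s i < nth 0 s i.+1]|.

Definition word (n : nat) (p : 'S_n) : seq nat :=
  [seq val (p i) | i <- enum 'I_n].

(* [enum I] lists the positions in [I] in increasing order. *)
Definition subword (n : nat) (p : 'S_n) (I : {set 'I_n}) : seq nat :=
  [seq val (p i) | i <- enum I].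

Definition lis (n : nat) (p : 'S_n) : nat :=
  \max_(I : {set 'I_n} | sorted ltn (subword p I)) #|I|.

(* The maximum over an empty family is 0. *)
Definition ls (d n : nat) (p : 'S_n) : nat :=
  \max_(I : {set 'I_n} | des (subword p I) == d) #|I|.

(* Main.v *)
Require Import Defs.
From mathcomp Require Import all_boot all_fingroup.
From mathcomp Require Import zify.

(** Write [s] for the word of [p] and [k] for its [lis].  Deleting a letter of
    a word with at least two letters, all distinct, lowers exactly one of its
    numbers of ascents and descents by one and keeps the other.  So both are
    monotone along subsequences ([adj_subseq]), and a subsequence with [d]
    descents has length at most [asc s + d + 1].  Deleting the letters of [s]
    one by one down to a given subsequence [t], one meets every number of
    descents between those of [t] and [s]; hence for each such number [d] there
    is a subsequence with exactly [d] descents that contains [t] and is longer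
    by at least the number of added descents ([extend_to_des]).  Applied to a
    longest increasing subsequence this gives [lis p + d <= ls d p], and the two
    bounds agree when [asc s = k - 1].

    Conversely let [ls d p = k + d].  By the extension argument a subsequence
    with one descent has length at most [k + 1], so an increasing subsequence of
    a prefix of [s] and one of the complementary suffix have total length at
    most [k + 1].  Let [R] be an increasing run, [s = u ++ R ++ v].  A longest
    increasing subsequence of [s] can be traded for increasing
    subsequences of [u ++ R] and of [R ++ v] of total length at least
    [k + size R] ([run_exchange]).  Comparing this with the bound for the split
    of [s] before [R], the length of a longest increasing subsequence of the
    prefix grows by at least [size R - 1], the number of ascents of [R], when
    [R] is added to [u]; and by [size R] for the first run.  Summing over all
    runs yields [asc s + 1 <= k] ([asc_lt_of_splits]). *)

Set Implicit Arguments.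
Unset Strict Implicit.
Unset Printing Implicit Defensive.

(** * Adjacent pairs of a word *)

Fixpoint adj (r : rel nat) (s : seq nat) : nat :=
  if s is x :: s' then (if s' is y :: _ then r x y else false) + adj r s'
  else 0.

Lemma card_adj (r : rel nat) (s : seq nat) :
  #|[set i : 'I_(size s).-1 | r (nth 0 s i) (nth 0 s i.+1)]| = adj r s.
Proof.
rewrite cardsE -sum1_card big_mkcond /=.
elim: s => [|x [|y s] IH]; [by rewrite big_ord0 | by rewrite big_ord0 |].
rewrite big_ord_recl [RHS]/= -[(_ + adj r s)%N]/(adj r (y :: s)) -IH.
by congr (_ + _); rewrite unfold_in /=; case: (r x y).
Qed.

Lemma desE (s : seq nat) : des s = adj gtn s.
Proof. exact: (card_adj gtn). Qed.

Lemma ascE (s : seq nat) : asc s = adj ltn s.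
Proof. exact: (card_adj ltn). Qed.

Lemma adj_cat (r : rel nat) (s t : seq nat) :
  adj r s + adj r t <= adj r (s ++ t) <= adj r s + adj r t + 1.
Proof.
elim: s => [|x [|y s] IH] /=; first lia.
  by case: t {IH} => [|z t] //=; case: (r x z); lia.
by move: IH => /=; case: (r x y); lia.
Qed.

Lemma adj_rcons (r : rel nat) (s : seq nat) (x y : nat) :
  adj r (rcons (rcons s x) y) = adj r (rcons s x) + r x y.
Proof.
elim: s => [|z s IH] /=; first by case: (r x y).
by rewrite IH addnA; case: s {IH}.
Qed.

Lemma asc_add_des (s : seq nat) :
  uniq s -> adj ltn s + adj gtn s = (size s).-1.
Proof.
elim: s => [|x [|y s] IH] //= /andP[+ /IH /= <-].
by rewrite inE negb_or => /andP[/eqP xy _]; lia.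
Qed.

(** Negative transitivity, which holds for [ltn] and [gtn], says that an adjacent
    pair created by a deletion replaces at least one adjacent pair of the same
    kind. *)
Lemma adj_subseq (r : rel nat) (s t : seq nat) :
  (forall x y z, r x z -> r x y || r y z) ->
  subseq t s -> adj r t <= adj r s.
Proof.
move=> cotr.
have del x y u : adj r (x :: u) <= adj r (x :: y :: u).
  case: u => [|z u] //=; have := cotr x y z.
  by case: (r x z) (r x y) (r y z) => [] [] [] //= H; rewrite ?(H isT); lia.
have cons x u v : subseq u v -> adj r (x :: u) <= adj r (x :: v).
  elim: v u x => [|y v IH] u x; first by move/eqP->.
  case: u => [|z u] //=.
  case: eqP => [-> /(IH _ y)|_ /(IH _ x) H]; first by rewrite leq_add2l.
  exact: leq_trans H (del _ _ _).
elim: s t => [|y s IH] [|x t] //=.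
case: eqP => [-> /(cons y) //|_ /IH H].
exact: leq_trans H (leq_addl _ _).
Qed.

Lemma asc_subseq (s t : seq nat) : subseq t s -> adj ltn t <= adj ltn s.
Proof. by apply: adj_subseq => x y z /=; lia. Qed.

Lemma des_subseq (s t : seq nat) : subseq t s -> adj gtn t <= adj gtn s.
Proof. by apply: adj_subseq => x y z /=; lia. Qed.

Lemma des_sorted (s : seq nat) : sorted ltn s -> adj gtn s = 0.
Proof.
elim: s => [|x [|y s] IH] //= /andP[xy /IH /= ->].
by rewrite ltnNge ltnW.
Qed.

Lemma sorted_des (s : seq nat) : uniq s -> adj gtn s = 0 -> sorted ltn s.
Proof.
elim: s => [|x [|y s] IH] //= /andP[+ us] d0.
rewrite inE negb_or => /andP[/eqP xy _].
by apply/andP; split; [move: d0 | apply: IH => //; move: d0] => /=; lia.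
Qed.

(** * Extending a subsequence to a prescribed number of descents *)

Lemma subseq_del1 (s t : seq nat) :
  subseq t s -> t != s ->
  exists s' : seq nat, [/\ subseq t s', subseq s' s & (size s').+1 = size s].
Proof.
elim: s t => [|y s IH] [|x t] //=.
  by exists s; split; [exact: sub0seq | exact: subseq_cons |].
case: (x =P y) => [-> ts|_ ts _]; 
  last by exists s; split=> //; exact: subseq_cons.
rewrite eqseq_cons eqxx /= => /(IH _ ts)[s' [ts' s's <-]].
by exists (y :: s'); rewrite /= eqxx.
Qed.

(** One deletion changes the number of descents by at most one, so no value is
    skipped on the way from [s] down to [t]. *)
Lemma subseq_des_between (s t : seq nat) (d : nat) :
  uniq s -> subseq t s -> adj gtn t <= d <= adj gtn s ->
  exists t' : seq nat, [/\ subseq t t', subseq t' s & adj gtn t' = d].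
Proof.
have [m] := ubnP (size s); elim: m s => // m IH s sm us ts /andP[td ds].
have [sd|sd] := eqVneq (adj gtn s) d; first by exists s.
have tNs : t != s by apply: contraNneq sd => eq_ts; rewrite eqn_leq ds -eq_ts td.
have [s' [ts' s's szs']] := subseq_del1 ts tNs.
have us' := subseq_uniq s's us.
have [] := IH s' _ us' ts'; first by lia.
- have := asc_add_des us; have := asc_add_des us'; have := asc_subseq s's.
  by lia.
move=> t' [tt' t's' <-]; exists t'; split=> //.
exact: subseq_trans s's.
Qed.

Lemma extend_to_des (s t : seq nat) (d : nat) :
  uniq s -> subseq t s -> adj gtn t <= d <= adj gtn s -> 0 < size t ->
  exists t' : seq nat,
    [/\ subseq t' s, adj gtn t' = d & size t + d <= size t' + adj gtn t].
Proof.
move=> us ts tds t0; have [t' [tt' t's t'd]] := subseq_des_between us ts tds.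
exists t'; split=> //.
have := asc_add_des (subseq_uniq t's us); have := asc_add_des (subseq_uniq ts us).
by have := asc_subseq tt'; have /= := size_subseq tt'; lia.
Qed.

Lemma size_subseq_asc (s t : seq nat) :
  uniq s -> subseq t s -> size t <= adj ltn s + adj gtn t + 1.
Proof.
move=> us ts; have := asc_add_des (subseq_uniq ts us).
by have := asc_subseq ts; lia.
Qed.

(** * Increasing runs *)

Lemma subseq_cat_split (T : eqType) (s u v : seq T) :
  subseq s (u ++ v) ->
  exists a b, [/\ s = a ++ b, subseq a u & subseq b v].
Proof.
elim: u s => [|x u IH] s; first by move=> sv; exists [::], s.
case: s => [|y s] /=; first by exists [::], [::]; rewrite !sub0seq.
case: (y =P x) => [-> /IH[a [b [-> au bv]]]|yx /IH[a [b [-> au bv]]]].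
  by exists (x :: a), b; rewrite /= eqxx.
exists a, b; split=> //; exact: subseq_trans (subseq_cons _ _).
Qed.

(** Write the given increasing subsequence as [A ++ C ++ B].  Append to [A] all
    letters of [R] that exceed [A], and prepend to [B] all letters of [R]
    below [B]: every letter of [R] is of one of these kinds since [A] lies
    below [B], and those of [C] are of both. *)
Lemma run_exchange (u R v I : seq nat) :
  sorted ltn R -> sorted ltn I -> subseq I (u ++ R ++ v) ->
  exists P S : seq nat,
    [/\ subseq P (u ++ R), sorted ltn P, subseq S (R ++ v),
        sorted ltn S & size I + size R <= size P + size S].
Proof.
move=> sR sI /subseq_cat_split[A [CB [defI Au CBRv]]].
have [C [B [defCB CR Bv]]] := subseq_cat_split CBRv.
subst I CB; clear CBRv; move: sI; rewrite !(sorted_pairwise ltn_trans) in sR *.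
rewrite !pairwise_cat allrel_catr -!andbA.
case/and5P=> rAC rAB pA rCB /andP[pC pB].
pose aA x := all (fun a => a < x) A; pose bB x := all (ltn x) B.
exists (A ++ filter aA R), (filter bB R ++ B).
rewrite !(sorted_pairwise ltn_trans) !pairwise_cat !pairwise_filter //.
rewrite !cat_subseq ?filter_subseq // pA pB; split=> //.
- rewrite !andbT; apply/allrelP => a x aA'.
  by rewrite mem_filter => /andP[/allP/(_ a aA')].
- rewrite !andbT; apply/allrelP => x b.
  by rewrite mem_filter => /andP[/allP bx _] /bx.
rewrite !size_cat !size_filter.
have cU : count (predU aA bB) R = size R.
  apply/eqP; rewrite -all_count; apply/allP => x _ /=.
  case: (boolP (aA x)) => //= /allPn[a aA' xa]; apply/allP => b bB'.
  by have /allrelP/(_ a b aA' bB') /= := rAB; lia.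
have cI : size C <= count (predI aA bB) R.
  rewrite -size_filter; apply: size_subseq; rewrite subseq_filter CR andbT.
  apply/allP => c cC; apply/andP; split; apply/allP => b Hb.
    by have /allrelP := rAC; apply.
  by have /allrelP := rCB; apply.
by have := count_predUI aA bB R; move: cI; rewrite cU /=; lia.
Qed.

(** For the split with empty prefix the hypothesis asks for [k] to bound the
    lengths of the increasing subsequences of [s]; the boolean, which is then
    [0], is the saving that makes the final inequality strict. *)
Lemma asc_lt_of_splits (s I : seq nat) (k : nat) :
  (forall u v P S : seq nat, s = u ++ v -> subseq P u -> subseq S v ->
     sorted ltn P -> sorted ltn S -> size P + size S <= k + (0 < size u)) ->
  subseq I s -> sorted ltn I -> size I = k -> 0 < size s ->
  adj ltn s < k.
Proof.
move=> split_le Is sI Ik.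
(* [s] is read from left to right; [rcons R x] is the part already read of the
   current run and [P] a long increasing subsequence of the runs before it.
   The next letter [y] either extends the run, or closes it if [y <= x], and
   then [run_exchange] supplies the subsequence [P'] that includes this run. *)
have sweep (v : seq nat) : forall (u R : seq nat) x (P : seq nat),
    s = u ++ rcons R x ++ v -> subseq P u ->
    sorted ltn P -> sorted ltn (rcons R x) ->
    adj ltn (u ++ rcons R x) + 1 + (0 < size u) <= size P + size (rcons R x) ->
    adj ltn s < k.
  elim: v => [|y v IH] u R x P defs Pu sP sR le;
    have := Is; rewrite {1}defs => /(run_exchange sR sI)[P' [S [P'u sP' Sv sS le']]];
    have := split_le _ _ _ _ defs Pu Sv sP sS => leS.
  - rewrite cats0 in defs *; rewrite -defs in P'u le.
    by have /= := split_le [::] s [::] P' erefl isT P'u isT sP'; lia.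
  have adjE : adj ltn ((u ++ rcons R x) ++ [:: y])
              = adj ltn (u ++ rcons R x) + (x < y).
    by rewrite cats1 -!rcons_cat adj_rcons.
  have [xy|yx] := ltnP x y.
    apply: (IH u (rcons R x) y P) => //.
    - by rewrite defs (cat_rcons y).
    - move: sR; case: (R) => [|z R'] /=; first by rewrite xy.
      by rewrite !rcons_path last_rcons /= xy => ->.
    rewrite -(cats1 (rcons R x)) catA adjE xy size_cat /=; lia.
  apply: (IH (u ++ rcons R x) [::] y P') => //=; first by rewrite defs -catA.
  rewrite adjE ltnNge yx /=.
  have -> : 0 < size (u ++ rcons R x) by rewrite size_cat size_rcons addnS.
  by lia.
case: s split_le Is sweep => // x s split_le Is sweep _.
by apply: (sweep s [::] [::] x [::]).
Qed.

(** * Distinct words *)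

(** [L] and [k] are given by what makes them the maximal lengths of the
    subsequences with [d] descents and of the increasing ones. *)
Lemma max_des_eq_iff (s : seq nat) (d k L : nat) :
  uniq s -> 1 <= d <= adj gtn s ->
  (exists I : seq nat, [/\ subseq I s, sorted ltn I & size I = k]) ->
  (forall t : seq nat, subseq t s -> sorted ltn t -> size t <= k) ->
  (forall t : seq nat, subseq t s -> adj gtn t = d -> size t <= L) ->
  (forall m,
     (forall t : seq nat, subseq t s -> adj gtn t = d -> size t <= m) ->
     L <= m) ->
  L = k + d <-> adj ltn s = k - 1.
Proof.
move=> us /andP[d1 ds] [I [Is sI Ik]] kmax Lub Lmin.
have s0 : 0 < size s by case: (s) ds => //=; lia.
have k0 : 0 < k.
  by case: (s) s0 kmax => // x s' _ /(_ [:: x]); apply=> //=; rewrite eqxx sub0seq.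
have kasc : k <= adj ltn s + 1.
  by have := size_subseq_asc us Is; rewrite (des_sorted sI) Ik addn0.
have Lge : k + d <= L.
  have [] := @extend_to_des s I d us Is; rewrite ?(des_sorted sI) ?Ik //.
  by move=> t' [t's t'd]; have := Lub _ t's t'd; lia.
split=> [Leq|asck]; last first.
  apply/eqP; rewrite eqn_leq Lge andbT; apply: Lmin => t ts td.
  by have := size_subseq_asc us ts; lia.
suff : adj ltn s < k by lia.
apply: (asc_lt_of_splits _ Is sI Ik s0) => u v P S defs Pu Sv sP sS.
have PSs : subseq (P ++ S) s by rewrite defs cat_subseq.
have uPS := subseq_uniq PSs us.
have desPS : adj gtn (P ++ S) <= 1.
  by have := adj_cat gtn P S; rewrite (des_sorted sP) (des_sorted sS) => /andP[].
rewrite -size_cat; have [des0|des1] := posnP (adj gtn (P ++ S)).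
  by have := kmax _ PSs (sorted_des uPS des0); lia.
have uN0 : 0 < size u.
  by case: (u) Pu des1 => // /eqP->; rewrite des_sorted.
have PS0 : 0 < size (P ++ S) by case: (P ++ S) des1.
have [|t [ts td le]] := @extend_to_des s (P ++ S) d us PSs _ PS0; first by lia.
by have := Lub _ ts td; rewrite uN0; lia.
Qed.

(** * Subsets of positions and subsequences *)

Lemma uniq_word (n : nat) (p : 'S_n) : uniq (word p).
Proof.
by rewrite map_inj_uniq ?enum_uniq // => i j /val_inj /perm_inj.
Qed.

Lemma subword_subseq (n : nat) (p : 'S_n) (I : {set 'I_n}) :
  subseq (subword p I) (word p).
Proof. by apply: map_subseq; rewrite enumT; exact: filter_subseq. Qed.

Lemma size_subword (n : nat) (p : 'S_n) (I : {set 'I_n}) :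
  size (subword p I) = #|I|.
Proof. by rewrite size_map -cardE. Qed.

Lemma subseq_subword (n : nat) (p : 'S_n) (t : seq nat) :
  subseq t (word p) -> exists I, t = subword p I.
Proof.
case/subseqP=> m _ ->; rewrite /word -map_mask.
exists [set i in mask m (enum 'I_n)]; congr map.
rewrite {1}(elimT (subseq_uniqP (enum_uniq 'I_n)) (mask_subseq m (enum 'I_n))).
by rewrite [RHS]/enum_mem -enumT; apply: eq_filter => i; rewrite !inE.
Qed.

Lemma leq_max_subword (n : nat) (p : 'S_n) (Q : pred (seq nat)) (t : seq nat) :
  subseq t (word p) -> Q t ->
  size t <= \max_(I : {set 'I_n} | Q (subword p I)) #|I|.
Proof.
case/subseq_subword=> I -> QI; rewrite size_subword.
exact: (@leq_bigmax_cond _ (fun I => Q (subword p I)) (fun I => #|I|)).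
Qed.

Theorem proposition3p5 (n : nat) (p : 'S_n) (d : nat)
    (hd : 1 <= d <= des (word p)) :
  ls d p = lis p + d <-> asc (word p) = lis p - 1.
Proof.
rewrite ascE; apply: max_des_eq_iff; rewrite -?desE ?uniq_word //.
- have [|I sI eqI] := @eq_bigmax_cond _
    (fun I : {set 'I_n} => sorted ltn (subword p I)) (fun I => #|I|).
    by apply/card_gt0P; exists set0; rewrite unfold_in /subword enum_set0.
  exists (subword p I); split; first exact: subword_subseq.
    exact: sI.
  by rewrite size_subword; exact: esym eqI.
- by move=> t ts st; apply: (@leq_max_subword n p (sorted ltn)).
- move=> t ts td; apply: (@leq_max_subword n p (fun t => des t == d)) => //.
  by rewrite desE td.
- move=> m ub; apply/bigmax_leqP => I /eqP dI; rewrite -(size_subword p).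
  by apply: ub; rewrite ?subword_subseq // -desE.
Qed.
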